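(* Let $d\ge2$. Let $c\colon S^{d-1}\to S^{d-1}\vee S^{d-1}$ be the $(d-2)$-fold suspension of the map $S^1\to S^1\vee S^1$ given by the loop $xy^{-1}$, where $x,y$ are the two inclusions of $S^1$ into $S^1\vee S^1$, and let $X=(S^{d-1}\vee S^{d-1})\cup(D^d\amalg D^d)$ be the $d$-dimensional CW complex obtained by attaching two $d$-cells $e_1,e_2$ to $S^{d-1}\vee S^{d-1}$, each along $c$; let $f_1,f_2$ be the $(d-1)$-cells (so $\partial e_1=\partial e_2=f_1-f_2$), and take as initial cycle $z_0=f_1$, whose class generates $H_{d-1}(X;\mathbb Z)\cong\mathbb Z$. Let $W_1\colon[0,1]\to[-1,1]$ be any smooth function vanishing at $t\in\{0,1/2,1\}$ with $W_1(t)<0$ for $t\in(0,1/2)$ and $W_1(t)>0$ for $t\in(1/2,1)$, and set $W_2=-W_1$. Let $E_1\colon[0,1]\to[-1,1]$ be any smooth function with $E_1(1/2)=1$ and $E_1(0)=E_1(1)=-1$, and set $E_2=-E_1$. Use $W_i(t)$ as the weight of $e_i$ and $E_i(t)$ as the weight of $f_i$, and let $\gamma(t)=(E_\bullet(t),W_\bullet(t))$. Then the average current in the low temperature, adiabatic limit, $\lim_{\beta\to\infty}\lim_{\tau_D\to\infty}Q_{\tau_D,\beta}$, coincides with the generator of $H_d(X;\mathbb Z)\cong\mathbb Z$ given by the cycle $e_1-e_2$.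
   Context: $C_k(X;\mathbb R)$ denotes real cellular chains with boundary $\partial$; $\partial^*$ is the adjoint of $\partial$ for the inner products in which the cells are orthonormal. $e^{\beta E(t)}$ and $e^{\beta W(t)}$ are the diagonal operators $f_i\mapsto e^{\beta E_i(t)}f_i$ on $C_{d-1}(X;\mathbb R)$ and $e_i\mapsto e^{\beta W_i(t)}e_i$ on $C_d(X;\mathbb R)$. For $\beta>0$ and $\tau_D$ sufficiently large (depending on $\beta,\gamma$), the equation $\dot q=-\tau_D\,\partial e^{-\beta W(t)}\partial^*e^{\beta E(t)}q$ on $[0,1]$ has a unique periodic solution $\rho=\rho_{\tau_D,\beta}$, $\rho(0)=\rho(1)$, with values in the real $(d-1)$-cycles representing $[z_0]\in H_{d-1}(X;\mathbb R)$. The average current is $$Q_{\tau_D,\beta}=\int_0^1\tau_D\,e^{-\beta W(t)}\partial^*e^{\beta E(t)}\rho(t)\,dt\in Z_d(X;\mathbb R)=H_d(X;\mathbb R).$$ *)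

(* Defs.v *)
From HB Require Import structures.
From mathcomp Require Import all_boot all_order all_algebra.
From mathcomp Require Import all_classical all_reals all_analysis.

Set Implicit Arguments.
Unset Strict Implicit.
Unset Printing Implicit Defensive.

Import Order.TTheory GRing.Theory Num.Theory.
Import numFieldNormedType.Exports.

Local Open Scope classical_set_scope.
Local Open Scope ring_scope.

(* A finite CW complex enters through its cellular chain complex: its cells,
   their dimensions, and the incidence numbers [e : f], i.e. the degree of the
   attaching map of e followed by the collapse of the skeleton onto the sphere
   of f. *)
Record cell_complex := CellComplex {
  cell :> finType;
  dim : cell -> nat;
  inc : cell -> cell -> int;
  inc_dim : forall e f, inc e f != 0 -> dim e = (dim f).+1;
  inc_inc : forall e g, \sum_f inc e f * inc f g = 0 }.

Section Chains.
Variables (A : comNzRingType) (X : cell_complex).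

Definition kcell (k : nat) := {c : X | dim c == k}.

Definition chain (k : nat) := {ffun kcell k -> A}.

(* The 0-chain if x is not a k-cell. *)
Definition cell_chain (k : nat) (x : X) : chain k :=
  [ffun c => (val c == x)%:R].

(* For k = 0 this is the zero map of C_0, by [inc_dim]. *)
Definition bd (k : nat) (c : chain k) : chain k.-1 :=
  [ffun f => \sum_e c e * (inc (val e) (val f))%:~R].

Definition cobd (k : nat) (z : chain k.-1) : chain k :=
  [ffun e => \sum_f (inc (val e) (val f))%:~R * z f].

Definition chain_dot (k : nat) (c c' : chain k) : A := \sum_x c x * c' x.

Lemma cobd_adjoint (k : nat) (c : chain k) (z : chain k.-1) :
  chain_dot (bd c) z = chain_dot c (cobd z).
Proof.
rewrite /chain_dot.
under eq_bigr => f _ do rewrite ffunE mulr_suml.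
rewrite exchange_big /=; apply: eq_bigr => e _.
by rewrite ffunE mulr_sumr; apply: eq_bigr => f _; rewrite mulrA.
Qed.

Definition is_cycle (k : nat) (c : chain k) : Prop := bd c = 0.

Definition homologous (k : nat) (c c' : chain k) : Prop :=
  exists b : chain k.+1, c - c' = bd b.

End Chains.

(* H_k(X; Z) is infinite cyclic, generated by the class of z. *)
Definition generates_homology (X : cell_complex) (k : nat) (z : chain int X k)
    : Prop :=
  is_cycle z /\
  forall c : chain int X k, is_cycle c ->
    exists! m : int, homologous c (z *~ m).

Definition realify (R : realType) (X : cell_complex) (k : nat)
    (c : chain int X k) : chain R X k := [ffun x => (c x)%:~R].

Section Dynamics.
Variables (R : realType) (X : cell_complex) (d : nat).
Variables (E W : R -> X -> R).

(* The diagonal operator x |-> e^{b w(x)} x on k-chains. *)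
Definition exp_diag (k : nat) (b : R) (w : X -> R) (c : chain R X k)
    : chain R X k := [ffun x => expR (b * w (val x)) * c x].

(* e^{- beta W(t)} d^* e^{beta E(t)} q *)
Definition flux (beta t : R) (q : chain R X d.-1) : chain R X d :=
  exp_diag (- beta) (W t) (cobd (exp_diag beta (E t) q)).

(* Only the values of rho on [0, 1] matter.  By continuity, the equation on the
   open interval gives the equation with one-sided derivatives at 0 and 1. *)
Definition periodic_solution (z0 : chain R X d.-1) (tau beta : R)
    (rho : R -> chain R X d.-1) : Prop :=
  [/\ forall f, {within `[0, 1], continuous (fun t : R => rho t f)},
      forall (t : R) f, 0 < t < 1 ->
        is_derive t (1 : R) (fun s => rho s f)
          (- tau * bd (flux beta t (rho t)) f),
      rho 0 = rho 1
    & forall t : R, 0 <= t <= 1 -> is_cycle (rho t) /\ homologous (rho t) z0].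

Definition has_unique_periodic_solution (z0 : chain R X d.-1) (tau beta : R)
    : Prop :=
  exists rho, periodic_solution z0 tau beta rho /\
    forall rho', periodic_solution z0 tau beta rho' ->
      forall t : R, 0 <= t <= 1 -> rho' t = rho t.

(* The current of the periodic solution, and 0 if there is none. *)
Definition average_current (z0 : chain R X d.-1) (tau beta : R)
    : chain R X d :=
  let rho := xget (fun=> 0) [set r | periodic_solution z0 tau beta r] in
  [ffun e => \int[lebesgue_measure]_(t in `[0, 1])
               (tau * flux beta t (rho t) e)].

End Dynamics.

Definition chain_cvg (R : realType) (X : cell_complex) (k : nat)
    (u : R -> chain R X k) (F : set_system R) (l : chain R X k) : Prop :=
  forall x, u s x @[s --> F] --> l x.

Definition smooth_on (R : realType) (D : set R) (f : R -> R) : Prop :=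
  exists g : R -> R,
    (forall n x, derivable (derive1n n g) x 1) /\
    (forall t, D t -> f t = g t).

(* A word in the free group on n generators; (i, true) is the inverse of the
   generator i. *)
Definition word (n : nat) := seq ('I_n * bool).

(* The degree of the loop w followed by the collapse of the wedge of n circles
   onto the i-th one; suspending does not change it. *)
Definition exponent (n : nat) (w : word n) (i : 'I_n) : int :=
  \sum_(l <- w | l.1 == i) (-1) ^+ l.2.

(* For p > 0: a wedge of n p-spheres (one 0-cell and n p-cells) with m cells of
   dimension p + 1, the j-th one attached along the (p - 1)-fold suspension of
   the loop w j in a wedge of n circles. *)
Section WedgeComplex.
Variables (n m p : nat) (w : 'I_m -> word n).

Definition wedge_cell : finType := ('I_1 + 'I_n + 'I_m)%type.

Definition wedge_dim (c : wedge_cell) : nat :=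
  match c with inl (inl _) => 0 | inl (inr _) => p | inr _ => p.+1 end.

(* If p = 1, both ends of each 1-cell are the 0-cell, so that its boundary is
   zero. *)
Definition wedge_inc (e f : wedge_cell) : int :=
  match e, f with
  | inr j, inl (inr i) => exponent (w j) i
  | _, _ => 0
  end.

Lemma wedge_inc_dim e f :
  wedge_inc e f != 0 -> wedge_dim e = (wedge_dim f).+1.
Proof. by case: e f => [[?|?]|?] [[?|?]|?] //=; rewrite ?eqxx. Qed.

Lemma wedge_inc_inc e g : \sum_f wedge_inc e f * wedge_inc f g = 0.
Proof.
apply: big1 => f _.
by case: e f g => [[?|?]|?] [[?|?]|?] [[?|?]|?] //=; rewrite ?mulr0 ?mul0r.
Qed.

Definition wedge_complex : cell_complex :=
  CellComplex wedge_inc_dim wedge_inc_inc.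

End WedgeComplex.

(* The loop x y^{-1}. *)
Definition xyV : word 2 := [:: (ord0, false); (ord_max, true)].

Definition Xcomplex (d : nat) : cell_complex :=
  wedge_complex d.-1 (fun _ : 'I_2 => xyV).

Definition f_ (d : nat) (i : 'I_2) : Xcomplex d := inl (inr i).
Definition e_ (d : nat) (j : 'I_2) : Xcomplex d := inr j.

Definition f1 (d : nat) : chain int (Xcomplex d) d.-1 :=
  cell_chain int d.-1 (f_ d ord0).
Definition f2 (d : nat) : chain int (Xcomplex d) d.-1 :=
  cell_chain int d.-1 (f_ d ord_max).
Definition e1 (d : nat) : chain int (Xcomplex d) d :=
  cell_chain int d (e_ d ord0).
Definition e2 (d : nat) : chain int (Xcomplex d) d :=
  cell_chain int d (e_ d ord_max).

Lemma bd_e (d : nat) : (2 <= d)%N ->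
  bd (e1 d) = f1 d - f2 d /\ bd (e2 d) = f1 d - f2 d.
Proof.
have exp0 : exponent xyV ord0 = 1 by rewrite /exponent !big_cons big_nil.
have exp1 : exponent xyV ord_max = -1 by rewrite /exponent !big_cons big_nil.
case: d => [|[|k]] // _.
have main j (hj : dim (e_ k.+2 j) == k.+2) :
  bd (cell_chain int k.+2 (e_ k.+2 j)) = f1 k.+2 - f2 k.+2.
  apply/ffunP => -[[[v|i]|i] hi]; rewrite !ffunE /=.
  - by rewrite big1 // => -[[[?|?]|?] ?] _; rewrite ffunE /= ?mulr0.
  - rewrite (bigD1 (exist _ (e_ k.+2 j) hj)) //= big1 => [|e ne].
      rewrite !ffunE /= eqxx mul1r addr0 intz.
      have [->|->] : i = ord0 \/ i = ord_max.
        by case: i {hi} => -[|[|?]] // ?; [left|right]; exact: val_inj.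
      + by rewrite exp0.
      + by rewrite exp1.
    by rewrite ffunE; rewrite -val_eqE /= in ne; rewrite (negbTE ne) mul0r.
  - by move: hi => /=; rewrite -[X in X == _]addn1 -[X in _ == X]addn0 eqn_add2l.
by split; apply: main => /=.
Qed.

(* The weight a on the first cell and - a on the second one, in each of the
   dimensions d - 1 and d. *)
Definition opposite_weights (R : realType) (d : nat) (a : R -> R) (t : R)
    (c : Xcomplex d) : R :=
  match c with
  | inl (inl _) => 0
  | inl (inr i) | inr i => if i == ord0 then a t else - a t
  end.

Arguments opposite_weights {R} d a t c.

(* Main.v *)
(* In the class of f1, a real (d-1)-cycle is x f1 + (1 - x) f2, and the equation
   becomes x' = - tau a (x - s) with
     a = (e^{bW} + e^{-bW}) (e^{bE} + e^{-bE}) >= 1,  s = 1 / (1 + e^{2bE}),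
   where b = beta, W = W1, E = E1.  The periodic solution satisfies
   y = x - s = O(1 / tau), and the flux through e1 is
   p tau a y = - (p y)' + p' y - p s' with p = 1 / (1 + e^{2bW}), so that the
   current through e1 tends to - \int_0^1 p s' as tau tends to infinity; the
   current through e2 is its opposite since x is periodic.  As beta tends to
   infinity, p tends to 1 on (0, 1/2) and to 0 on (1/2, 1), and s(0) - s(1/2)
   tends to 1. *)

Require Import Defs.
From mathcomp Require Import all_boot all_order all_algebra.
From mathcomp Require Import all_classical all_reals all_analysis.
From mathcomp Require Import ring lra.

Set Implicit Arguments.
Unset Strict Implicit.
Unset Printing Implicit Defensive.

Import Order.TTheory GRing.Theory Num.Theory.
Import numFieldNormedType.Exports.
Local Open Scope classical_set_scope.
Local Open Scope ring_scope.

(** * Calculus on an interval *)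

Lemma is_derive_mul (R : realType) (f g : R -> R) (t df dg : R) :
  is_derive t 1 f df -> is_derive t 1 g dg ->
  is_derive t 1 (fun s => f s * g s) (df * g t + f t * dg).
Proof.
move=> Hf Hg; apply: is_derive_eq (is_deriveM Hf Hg) _.
by rewrite addrC /GRing.scale /= [g t * _]mulrC.
Qed.

Lemma is_derive_exp (R : realType) (f : R -> R) (t df : R) :
  is_derive t 1 f df ->
  is_derive t 1 (fun s => expR (f s)) (df * expR (f t)).
Proof.
move=> Hf; apply: is_derive_eq (is_derive1_comp (is_derive_expR _) Hf) _.
exact: mulrC.
Qed.

Lemma is_derive_inv (R : realType) (f : R -> R) (t df : R) :
  f t != 0 -> is_derive t 1 f df ->
  is_derive t 1 (fun s => (f s)^-1) (- df / f t ^+ 2).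
Proof.
move=> f0 Hf; apply: is_derive_eq (is_deriveV f0 Hf) _.
by rewrite /GRing.scale /= mulNr mulrC mulNr.
Qed.

Lemma within_exp (R : realType) (A : set R) (f : R -> R) :
  {within A, continuous f} ->
  {within A, continuous (fun t => expR (f t))}.
Proof.
move=> cf; apply: (@within_continuous_comp _ _ _ A f (@expR R) _ cf) => x _.
exact: continuous_expR.
Qed.

Lemma within_mul (R : realType) (A : set R) (f g : R -> R) :
  {within A, continuous f} -> {within A, continuous g} ->
  {within A, continuous (fun t => f t * g t)}.
Proof. by move=> cf cg x; apply: continuousM; [exact: cf|exact: cg]. Qed.

Lemma within_add (R : realType) (A : set R) (f g : R -> R) :
  {within A, continuous f} -> {within A, continuous g} ->
  {within A, continuous (fun t => f t + g t)}.
Proof. exact: within_continuousD. Qed.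

Lemma within_opp (R : realType) (A : set R) (f : R -> R) :
  {within A, continuous f} -> {within A, continuous (fun t => - f t)}.
Proof. by move=> cf x; apply: continuousN; exact: cf. Qed.

Lemma within_inv (R : realType) (A : set R) (f : R -> R) :
  (forall t, f t != 0) ->
  {within A, continuous f} -> {within A, continuous (fun t => (f t)^-1)}.
Proof. by move=> f0 cf x; apply: continuousV; [exact: f0|exact: cf]. Qed.

Lemma within_cst (R : realType) (A : set R) (c : R) :
  {within A, continuous (fun _ : R => c)}.
Proof. by apply: continuous_subspaceT => x; exact: cst_continuous. Qed.

Lemma within_eq (R : realType) (A : set R) (f g : R -> R) :
  (forall t, A t -> f t = g t) ->
  {within A, continuous f} -> {within A, continuous g}.
Proof. by move=> fg; apply: subspace_eq_continuous => t /set_mem /fg. Qed.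

(** Replaces integrals by increments of a primitive, so that later comparisons of integrals become
    mean value estimates. The same primitives serve as exponents of integrating factors. *)
Lemma continuous_primitive (R : realType) (a b : R) (f : R -> R) :
  a < b -> {within `[a, b], continuous f} ->
  exists F : R -> R,
    [/\ {within `[a, b], continuous F},
        forall t, a < t < b -> is_derive t 1 F (f t)
      & F b - F a = \int[lebesgue_measure]_(t in `[a, b]) f t].
Proof.
move=> ab cf.
have intf : lebesgue_measure.-integrable `[a, b] (EFin \o f).
  exact: continuous_compact_integrable (@segment_compact _ _ _) cf.
exists (fun x => parameterized_integral lebesgue_measure a x f); split.
- exact: parameterized_integral_continuous (ltW ab) intf.
- move=> t /andP[at' tb].
  have ct : {for t, continuous f}.
    have [+ _ _] := (continuous_within_itvP f ab).1 cf.
    by apply; rewrite in_itv /= at' tb.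
  have [dF F't] := continuous_FTC1_closed tb intf at' ct.
  by apply: DeriveDef; [exact: dF|rewrite -derive1E F't].
- by rewrite /parameterized_integral set_itv1 Rintegral_set1 subr0.
Qed.

Lemma increment_bound (R : realType) (a b K : R) (f df : R -> R) :
  a <= b -> {within `[a, b], continuous f} ->
  (forall t, a < t < b -> is_derive t 1 f (df t)) ->
  (forall t, a < t < b -> `|df t| <= K) ->
  `|f b - f a| <= K * (b - a).
Proof.
rewrite le_eqVlt => /predU1P[<-|ab] cf Hf HK.
  by rewrite !subrr normr0 mulr0.
have [c cab ->] := MVT ab Hf cf.
rewrite normrM [`|b - a|]ger0_norm ?subr_ge0 ?(ltW ab)// ler_wpM2r ?subr_ge0 ?(ltW ab)//.
by apply: HK; move: cab; rewrite in_itv.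
Qed.

Lemma le0_derive_le (R : realType) (a b : R) (f df : R -> R) :
  a <= b -> {within `[a, b], continuous f} ->
  (forall t, a < t < b -> is_derive t 1 f (df t)) ->
  (forall t, a < t < b -> df t <= 0) ->
  f b <= f a.
Proof.
rewrite le_eqVlt => /predU1P[<-//|ab] cf Hf HK.
have [c cab] := MVT ab Hf cf.
rewrite in_itv /= in cab => E.
by rewrite -subr_le0 E mulr_le0_ge0 ?HK ?subr_ge0 ?(ltW ab).
Qed.

(** * Linear equations with periodic boundary condition *)

(** Nondegeneracy of the periodic boundary condition: the factor $e^{A(0)}-e^{A(1)}$ can be divided
    by. *)
Lemma exp_primitive_lt (R : realType) (a A : R -> R) :
  {within `[0, 1], continuous A} ->
  (forall t : R, 0 < t < 1 -> is_derive t 1 A (a t)) ->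
  (forall t : R, 0 < t < 1 -> 0 < a t) ->
  expR (A 0) < expR (A 1).
Proof.
move=> cA HA a0; rewrite ltr_expR -subr_gt0.
have [c c01 ->] := MVT ltr01 HA cA.
by rewrite subr0 mulr1 a0 //; move: c01; rewrite in_itv.
Qed.

(* [(y - M / m) e^A], with [A' = a], is nonincreasing, so [y 0 = y 1] forces
   [y 0 <= M / m]. *)
Lemma periodic_le (R : realType) (a r y : R -> R) (m M : R) :
  0 < m -> 0 <= M ->
  {within `[0, 1], continuous a} -> {within `[0, 1], continuous y} ->
  (forall t : R, 0 < t < 1 -> m <= a t) ->
  (forall t : R, 0 < t < 1 -> r t <= M) ->
  (forall t : R, 0 < t < 1 -> is_derive t 1 y (r t - a t * y t)) ->
  y 0 = y 1 ->
  forall t : R, 0 <= t <= 1 -> y t <= M / m.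
Proof.
move=> m0 M0 ca cy ma rM Hy y01.
have [A [cA HA _]] := continuous_primitive ltr01 ca.
set K := M / m.
have K0 : 0 <= K by rewrite divr_ge0 // ltW.
pose g t := (y t + - K) * expR (A t).
have cg : {within `[0, 1], continuous g}.
  by apply: within_mul (within_exp cA); exact: within_add cy (@within_cst _ _ _).
have Hg (t : R) : 0 < t < 1 -> is_derive t 1 g ((r t - a t * K) * expR (A t)).
  move=> t01; apply: is_derive_eq.
    apply: is_derive_mul (is_derive_exp (HA _ t01)).
    exact: is_deriveD (Hy _ t01) (is_derive_cst _ _ _).
  by rewrite /=; ring.
have g'0 (t : R) : 0 < t < 1 -> (r t - a t * K) * expR (A t) <= 0.
  move=> t01; rewrite mulr_le0_ge0 ?expR_ge0 // subr_le0.
  rewrite (le_trans (rM _ t01)) // (_ : M = m * K); last first.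
    by rewrite /K mulrC divfK // gt_eqF.
  by rewrite ler_wpM2r ?ma.
have g_le (s t : R) : 0 <= s -> s <= t -> t <= 1 -> g t <= g s.
  move=> s0 st t1; apply: (le0_derive_le st
    (df := fun t => (r t - a t * K) * expR (A t))).
  - apply: continuous_subspaceW cg => u /=; rewrite !in_itv /= => /andP[u1 u2].
    by rewrite (le_trans s0) // (le_trans u2).
  - move=> u /andP[u1 u2]; apply: Hg.
    by rewrite (le_lt_trans s0) // (lt_le_trans u2).
  - move=> u /andP[u1 u2]; apply: g'0.
    by rewrite (le_lt_trans s0) // (lt_le_trans u2).
(* Since [y 0 = y 1], the inequality [g 1 <= g 0] reads $(y(0)-K)(e^{A(1)}-e^{A(0)})\le 0$. *)
have y0K : y 0 <= K.
  have := g_le _ _ (lexx 0) ler01 (lexx 1); rewrite /g -y01.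
  rewrite -subr_le0 -mulrBr pmulr_lle0 ?subr_le0 ?subr_gt0 //.
  by apply: exp_primitive_lt cA HA _ => t /ma; exact: lt_le_trans.
move=> t /andP[t0 t1].
have : g t <= 0.
  apply: (le_trans (g_le _ _ (lexx 0) t0 t1)).
  by rewrite /g mulr_le0_ge0 ?expR_ge0 // subr_le0.
by rewrite /g pmulr_lle0 ?expR_gt0 // subr_le0.
Qed.

(** The one-sided bound applies to $y$ and to $-y$. It yields $y=O(1/\tau)$ when $a\ge\tau$, and
    uniqueness when [r] is zero. *)
Lemma periodic_bound (R : realType) (a r y : R -> R) (m M : R) :
  0 < m -> 0 <= M ->
  {within `[0, 1], continuous a} -> {within `[0, 1], continuous y} ->
  (forall t : R, 0 < t < 1 -> m <= a t) ->
  (forall t : R, 0 < t < 1 -> `|r t| <= M) ->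
  (forall t : R, 0 < t < 1 -> is_derive t 1 y (r t - a t * y t)) ->
  y 0 = y 1 ->
  forall t : R, 0 <= t <= 1 -> `|y t| <= M / m.
Proof.
move=> m0 M0 ca cy ma rM Hy y01 t t01; rewrite ler_norml lerNl; apply/andP; split.
  apply: (periodic_le (y := fun t => - y t) (r := fun t => - r t) m0 M0 ca) t01 => //.
  - exact: within_opp.
  - by move=> u /rM; apply: le_trans; rewrite -normrN ler_norm.
  - move=> u u01; apply: is_derive_eq (is_deriveN (Hy _ u01)) _; ring.
  - by rewrite y01.
apply: (periodic_le (r := r) m0 M0 ca cy) t01 => // u /rM.
by apply: le_trans; exact: ler_norm.
Qed.

(** Variation of constants: if $A'=a$ and $B'=be^A$, then $(B+c)e^{-A}$ solves the equation for
    every constant $c$. *)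
Lemma periodic_exists (R : realType) (a b : R -> R) :
  {within `[0, 1], continuous a} -> {within `[0, 1], continuous b} ->
  (forall t : R, 0 < t < 1 -> 0 < a t) ->
  exists y : R -> R,
    [/\ {within `[0, 1], continuous y},
        forall t : R, 0 < t < 1 -> is_derive t 1 y (b t - a t * y t)
      & y 0 = y 1].
Proof.
move=> ca cb a0.
have [A [cA HA _]] := continuous_primitive ltr01 ca.
have [B [cB HB _]] := continuous_primitive ltr01 (within_mul cb (within_exp cA)).
(* The solution of $(B(0)+c)e^{-A(0)}=(B(1)+c)e^{-A(1)}$. *)
pose c := (B 0 * expR (A 1) - B 1 * expR (A 0)) / (expR (A 0) - expR (A 1)).
exists (fun t => (B t + c) / expR (A t)); split.
- apply: within_mul; first exact: within_add cB (@within_cst _ _ _).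
  by apply: within_inv (within_exp cA) => t; rewrite gt_eqF ?expR_gt0.
- move=> t t01; have e0 : expR (A t) != 0 by rewrite gt_eqF ?expR_gt0.
  apply: is_derive_eq.
    apply: is_derive_mul.
      exact: is_deriveD (HB _ t01) (is_derive_cst _ _ _).
    exact: (is_derive_inv (f := fun s => expR (A s)) e0 (is_derive_exp (HA _ t01))).
  by rewrite /=; field.
- have lt01 := exp_primitive_lt cA HA a0.
  have d0 : expR (A 0) - expR (A 1) != 0 by rewrite lt_eqF // subr_lt0.
  rewrite /c; field; rewrite d0 /=.
  by rewrite !gt_eqF ?expR_gt0.
Qed.

(** * The logistic function *)

(** The Gibbs weight $e^{-z}/(e^z+e^{-z})$, decreasing from 1 to 0. At $\beta E_1$ it is the
    equilibrium coefficient of $f_1$, at $\beta W_1$ the share of the total current that passes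
    through $e_1$. *)
Definition logistic (R : realType) (z : R) : R := (1 + expR (2 * z))^-1.

Definition dlogistic (R : realType) (z : R) : R :=
  - (2 * expR (2 * z)) / (1 + expR (2 * z)) ^+ 2.

Lemma logistic_den_gt0 (R : realType) (z : R) : 0 < 1 + expR (2 * z).
Proof. by rewrite addr_gt0 ?expR_gt0. Qed.

Lemma is_derive_logistic (R : realType) (f : R -> R) (t df : R) :
  is_derive t 1 f df ->
  is_derive t 1 (fun s => logistic (f s)) (dlogistic (f t) * df).
Proof.
move=> Hf; have d0 : 1 + expR (2 * f t) != 0 by rewrite gt_eqF ?logistic_den_gt0.
have He := is_derive_exp (is_derive_mul (is_derive_cst (2 : R) t 1) Hf).
apply: is_derive_eq.
  exact: (is_derive_inv (f := fun s => 1 + expR (2 * f s)) d0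
    (is_deriveD (is_derive_cst (1 : R) t 1) He)).
rewrite /dlogistic /=; field.
by rewrite gt_eqF ?logistic_den_gt0.
Qed.

Lemma within_logistic (R : realType) (A : set R) (f : R -> R) :
  {within A, continuous f} ->
  {within A, continuous (fun t => logistic (f t))}.
Proof.
move=> cf; apply: within_inv => [t|]; first by rewrite gt_eqF ?logistic_den_gt0.
apply: within_add (@within_cst _ _ _) _; apply: within_exp.
exact: within_mul (@within_cst _ _ _) cf.
Qed.

Lemma within_dlogistic (R : realType) (A : set R) (f : R -> R) :
  {within A, continuous f} ->
  {within A, continuous (fun t => dlogistic (f t))}.
Proof.
move=> cf; have ce : {within A, continuous (fun t => expR (2 * f t))}.
  by apply: within_exp; exact: within_mul (@within_cst _ _ _) cf.
apply: within_mul.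
  by apply: within_opp; exact: within_mul (@within_cst _ _ _) ce.
apply: within_inv => [t|]; first by rewrite gt_eqF ?exprn_gt0 ?logistic_den_gt0.
by apply: within_mul; exact: within_add (@within_cst _ _ _) ce.
Qed.

Lemma logistic_ge0 (R : realType) (z : R) : 0 <= logistic z.
Proof. by rewrite invr_ge0 ltW ?logistic_den_gt0. Qed.

Lemma logisticN (R : realType) (z : R) : logistic (- z) = 1 - logistic z.
Proof.
rewrite /logistic mulrN expRN; field.
by rewrite addrC !gt_eqF ?logistic_den_gt0 ?expR_gt0.
Qed.

Lemma logistic_le1 (R : realType) (z : R) : logistic z <= 1.
Proof. by rewrite -subr_ge0 -logisticN logistic_ge0. Qed.

Lemma logistic_le (R : realType) (z : R) : logistic z <= expR (- (2 * z)).
Proof.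
by rewrite expRN lef_pV2 ?posrE ?logistic_den_gt0 ?expR_gt0 // lerDr.
Qed.

(** The derivative is $-2$ times [logistic z * logistic (- z)]. The factor with the nonnegative
    argument is exponentially small and the other is at most 1. *)
Lemma dlogistic_le (R : realType) (z : R) :
  `|dlogistic z| <= 2 * expR (- (2 * `|z|)).
Proof.
have -> : `|dlogistic z| = 2 * (logistic z * logistic (- z)).
  rewrite logisticN /dlogistic /logistic normrM normrN.
  rewrite ger0_norm ?mulr_ge0 ?expR_ge0 //.
  rewrite ger0_norm ?invr_ge0 ?exprn_ge0 ?(ltW (logistic_den_gt0 _)) //.
  by field; rewrite gt_eqF ?logistic_den_gt0.
rewrite ler_pM2l //; have [z0|z0] := lerP 0 z.
  rewrite ger0_norm // -[leRHS]mulr1.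
  by rewrite ler_pM ?logistic_ge0 ?logistic_le ?logistic_le1.
rewrite ltr0_norm // -[leRHS]mul1r.
by rewrite ler_pM ?logistic_ge0 ?logistic_le ?logistic_le1.
Qed.

Lemma dlogistic_le2 (R : realType) (z : R) : `|dlogistic z| <= 2.
Proof.
rewrite (le_trans (dlogistic_le z)) // -[leRHS]mulr1.
by rewrite ler_pM2l // expR_le1 oppr_le0 mulr_ge0.
Qed.

(** * The scalar equation *)

Lemma within_bounded (R : realType) (f : R -> R) :
  {within `[0, 1], continuous f} ->
  exists2 M : R, 0 <= M & forall t : R, 0 <= t <= 1 -> `|f t| <= M.
Proof.
move=> cf.
have cn : {within `[0, 1], continuous (fun t => `|f t|)}.
  by move=> x; apply: (continuous_comp (cf x)); exact: norm_continuous.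
have [c _ Hc] := EVT_max ler01 cn.
by exists `|f c|.
Qed.

(** Whichever exponent is nonnegative already contributes 1. *)
Lemma expRDN_ge1 (R : realType) (z : R) : 1 <= expR z + expR (- z).
Proof.
have expR_ge1 (w : R) : 0 <= w -> 1 <= expR w by rewrite -ler_expR expR0.
have [z0|z0] := lerP 0 z.
  by rewrite (le_trans (expR_ge1 _ z0)) // lerDl expR_ge0.
rewrite (@le_trans _ _ (expR (- z))) ?lerDr ?expR_ge0 // expR_ge1 //.
by rewrite oppr_ge0 ltW.
Qed.

(** Serves both limits: the errors are $O(1/\tau)$ for fixed $\beta$, then $O(1/\beta)$. *)
Lemma cvg_of_inv_bound (R : realType) (u : R -> R) (l C : R) :
  (forall t : R, 0 < t -> `|u t - l| <= C / t) -> u t @[t --> +oo] --> l.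
Proof.
move=> H; apply/cvgrPdist_le => e e0.
near=> t.
have t0 : 0 < t by near: t; apply: nbhs_pinfty_gt; exact: num_real.
have Ct : C / e <= t by near: t; apply: nbhs_pinfty_ge; exact: num_real.
rewrite distrC; apply: (le_trans (H t t0)).
by rewrite ler_pdivrMr // mulrC -ler_pdivrMr.
Unshelve. all: by end_near.
Qed.

(** The first factor is the sum of $e^{-\beta W_j}$ over the two $d$-cells, the second the sum of
    $e^{\beta E_i}$ over the two $(d-1)$-cells. *)
Definition rate (R : realType) (E W : R -> R) (beta t : R) : R :=
  (expR (beta * W t) + expR (- (beta * W t))) *
  (expR (beta * E t) + expR (- (beta * E t))).

Definition scalar_solution (R : realType) (E W : R -> R) (tau beta : R)
    (x : R -> R) : Prop :=
  [/\ {within `[0, 1], continuous x},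
      forall t : R, 0 < t < 1 -> is_derive t 1 x
        (- tau * (rate E W beta t * (x t - logistic (beta * E t))))
    & x 0 = x 1].

Lemma rate_ge1 (R : realType) (E W : R -> R) (beta t : R) :
  1 <= rate E W beta t.
Proof. by rewrite -[leLHS]mulr1 ler_pM ?expRDN_ge1. Qed.

Lemma within_scale (R : realType) (A : set R) (c : R) (f : R -> R) :
  {within A, continuous f} -> {within A, continuous (fun t => c * f t)}.
Proof. exact: within_mul (@within_cst _ _ _). Qed.
Arguments within_scale {R A} c {f} _ [x t] _.


Lemma within_rate (R : realType) (A : set R) (E W : R -> R) (beta : R) :
  {within A, continuous E} -> {within A, continuous W} ->
  {within A, continuous (rate E W beta)}.
Proof.
move=> cE cW.
by apply: within_mul; apply: within_add; apply: within_exp;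
  try apply: within_opp; apply: within_scale.
Qed.
Arguments within_rate {R A E W} beta _ _ [x t] _.


Lemma scalar_solution_exists (R : realType) (E W : R -> R) (tau beta : R) :
  {within `[0, 1], continuous E} -> {within `[0, 1], continuous W} ->
  0 < tau -> exists x, scalar_solution E W tau beta x.
Proof.
move=> cE cW tau0; have ca := within_scale tau (within_rate beta cE cW).
have cs := within_logistic (within_scale beta cE).
have [t _|x [cx Hx x01]] := periodic_exists ca (within_mul ca cs).
  by rewrite mulr_gt0 // (lt_le_trans ltr01) ?rate_ge1.
exists x; split=> // t t01.
by apply: is_derive_eq (Hx t t01) _; ring.
Qed.

Lemma scalar_solution_unique (R : realType) (E W : R -> R) (tau beta : R)
    (x x' : R -> R) :
  {within `[0, 1], continuous E} -> {within `[0, 1], continuous W} ->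
  0 < tau -> scalar_solution E W tau beta x -> scalar_solution E W tau beta x' ->
  forall t : R, 0 <= t <= 1 -> x t = x' t.
Proof.
move=> cE cW tau0 [cx Hx x01] [cx' Hx' x'01] t t01.
have ca := within_scale tau (within_rate beta cE cW).
(* Writing the bound 0 as [0 / tau] gives it the shape of the periodic bound; the difference of two
   solutions solves the equation with zero forcing. *)
apply/eqP; rewrite -subr_eq0 -normr_le0 -(mul0r tau^-1).
apply: (periodic_bound (y := fun t => x t - x' t) (r := fun=> 0) tau0
  (lexx 0) ca) t01.
- by apply: within_add cx _; exact: within_opp.
- by move=> u _; rewrite ler_peMr ?rate_ge1 ?ltW.
- by move=> u _; rewrite normr0.
- move=> u u01; apply: is_derive_eq (is_deriveB (Hx _ u01) (Hx' _ u01)) _.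
  by rewrite /=; ring.
- by rewrite x01 x'01.
Qed.

(** The current through $e_1$, as the share of $e_1$ times the total current. Replacing $W$ by $-W$
    gives the current through $e_2$. *)
Definition current_density (R : realType) (E W : R -> R) (tau beta : R)
    (x : R -> R) (t : R) : R :=
  tau * (logistic (beta * W t) *
         (rate E W beta t * (x t - logistic (beta * E t)))).

Definition adiabatic_current (R : realType) (E dE W : R -> R) (beta : R) : R :=
  \int[lebesgue_measure]_(t in `[0, 1])
    - (logistic (beta * W t) * (dlogistic (beta * E t) * (beta * dE t))).

Lemma within_current_density (R : realType) (E W x : R -> R) (tau beta : R) :
  {within `[0, 1], continuous E} -> {within `[0, 1], continuous W} ->
  {within `[0, 1], continuous x} ->
  {within `[0, 1], continuous (current_density E W tau beta x)}.
Proof.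
move=> cE cW cx; apply: within_scale; apply: within_mul.
  exact/within_logistic/within_scale.
apply: within_mul; first exact: within_rate.
apply: within_add cx _; apply: within_opp.
exact/within_logistic/within_scale.
Qed.
Arguments within_current_density {R E W x} tau beta _ _ _ [x0 t] _.


(** The shares of the two $d$-cells add up to 1, so the two currents add up to $-x'$, and $x$ is
    periodic. Accordingly [S] in the proof is constant. *)
Lemma current_density_cycle (R : realType) (E W x : R -> R) (tau beta : R) :
  {within `[0, 1], continuous E} -> {within `[0, 1], continuous W} ->
  scalar_solution E W tau beta x ->
  \int[lebesgue_measure]_(t in `[0, 1])
    current_density E (fun t => - W t) tau beta x t =
  - \int[lebesgue_measure]_(t in `[0, 1]) current_density E W tau beta x t.
Proof.
move=> cE cW [cx Hx x01].
have [F [cF HF <-]] := continuous_primitive ltr01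
  (within_current_density tau beta cE cW cx).
have [G [cG HG <-]] := continuous_primitive ltr01
  (within_current_density tau beta cE (within_opp cW) cx).
pose S t := G t + F t + x t.
have : `|S 1 - S 0| <= 0 * (1 - 0).
  apply: (increment_bound (df := fun=> 0)) => // [|t t01|t _].
  - exact: within_add (within_add cG cF) cx.
  - apply: is_derive_eq.
      exact: is_deriveD (is_deriveD (HG _ t01) (HF _ t01)) (Hx _ t01).
    rewrite /= /current_density mulrN logisticN /rate mulrN opprK; ring.
  - by rewrite normr0.
by rewrite mul0r normr_le0 /S x01 => /eqP S01; lra.
Qed.

(* With [y = x - s] and [s = logistic (beta * E)], the current density is
   [- (p * y)' + p' * y - p * s'] for [p = logistic (beta * W)], and
   [y = O(1 / tau)]. *)
Lemma adiabatic_bound (R : realType) (E dE W dW : R -> R) (beta : R) :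
  {within `[0, 1], continuous E} -> {within `[0, 1], continuous W} ->
  {within `[0, 1], continuous dE} -> {within `[0, 1], continuous dW} ->
  (forall t : R, 0 < t < 1 -> is_derive t 1 E (dE t)) ->
  (forall t : R, 0 < t < 1 -> is_derive t 1 W (dW t)) ->
  E 0 = E 1 -> W 0 = W 1 -> 0 < beta ->
  exists C : R, forall (tau : R) (x : R -> R),
    0 < tau -> scalar_solution E W tau beta x ->
    `|\int[lebesgue_measure]_(t in `[0, 1]) current_density E W tau beta x t
      - adiabatic_current E dE W beta| <= C / tau.
Proof.
move=> cE cW cdE cdW HE HW E01 W01 b0.
have [ME ME0 HME] := within_bounded cdE.
have [MW MW0 HMW] := within_bounded cdW.
pose s t := logistic (beta * E t); pose p t := logistic (beta * W t).
pose ds t := dlogistic (beta * E t) * (beta * dE t).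
pose dp t := dlogistic (beta * W t) * (beta * dW t).
have cs : {within `[0, 1], continuous s} := within_logistic (within_scale beta cE).
have cp : {within `[0, 1], continuous p} := within_logistic (within_scale beta cW).
have cds : {within `[0, 1], continuous ds}.
  exact: within_mul (within_dlogistic (within_scale _ cE)) (within_scale _ cdE).
have Hlog (f df : R -> R) (t : R) : is_derive t 1 f (df t) ->
    is_derive t 1 (fun u => logistic (beta * f u))
      (dlogistic (beta * f t) * (beta * df t)).
  move=> Hf; apply: is_derive_eq.
    exact: is_derive_logistic (is_derive_mul (is_derive_cst beta t 1) Hf).
  by rewrite /=; ring.
have dlog_le (f df : R -> R) (t M : R) : `|df t| <= M ->
    `|dlogistic (beta * f t) * (beta * df t)| <= 2 * (beta * M).
  move=> dfM; rewrite normrM ler_pM ?dlogistic_le2 // normrM gtr0_norm //.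
  by rewrite ler_pM2l.
have [P [cP HP EP]] := continuous_primitive ltr01 (within_opp (within_mul cp cds)).
(* The first factor bounds $|p'|$; the second, divided by $\tau$, bounds $|y|$. *)
exists (2 * (beta * MW) * (2 * (beta * ME))) => tau x tau0 sol.
have [cx Hx x01] := sol.
have [G [cG HG <-]] := continuous_primitive ltr01
  (within_current_density tau beta cE cW cx).
rewrite /adiabatic_current -EP.
pose y t := x t - s t.
have cy : {within `[0, 1], continuous y} by apply: within_add cx (within_opp cs).
have Hy (t : R) : 0 < t < 1 -> is_derive t 1 y (- ds t - tau * rate E W beta t * y t).
  move=> t01; apply: is_derive_eq (is_deriveB (Hx _ t01) (Hlog E dE t (HE _ t01))) _.
  by rewrite /y /s /ds /=; ring.
have y01 : y 0 = y 1 by rewrite /y /s x01 E01.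
have y_le (t : R) : 0 <= t <= 1 -> `|y t| <= 2 * (beta * ME) / tau.
  apply: (periodic_bound (r := fun t => - ds t) tau0 _
    (within_scale tau (within_rate beta cE cW)) cy _ _ Hy y01).
  - by rewrite !mulr_ge0 // ltW.
  - by move=> u _; rewrite ler_peMr ?rate_ge1 ?ltW.
  - move=> u /andP[u0 u1]; rewrite normrN; apply: dlog_le.
    by apply: HME; rewrite !ltW.
(* [G] and [P] are primitives of the current density and of $-ps'$, so $S'=p'y$. The term $py$ is
   periodic and does not change the increment. *)
pose S t := G t + p t * y t + - P t.
have -> : G 1 - G 0 - (P 1 - P 0) = S 1 - S 0.
  by rewrite /S y01 /p W01; ring.
rewrite -[leRHS]mulr1 -[X in _ * X](subr0 1).
apply: (increment_bound (f := S) (df := fun t => dp t * y t) ler01) => [|t t01|t t01].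
- exact: within_add (within_add cG (within_mul cp cy)) (within_opp cP).
- apply: is_derive_eq.
    exact: is_deriveD (is_deriveD (HG _ t01)
      (is_derive_mul (Hlog W dW t (HW _ t01)) (Hy _ t01))) (is_deriveN (HP _ t01)).
  by rewrite /= /current_density /y /s /p /dp /ds; ring.
- have {t01} t01 : 0 <= t <= 1 by case/andP: t01 => *; rewrite !ltW.
  by rewrite normrM -mulrA ler_pM ?y_le // dlog_le ?HMW.
Qed.

(* [|p - 1_{t < 1/2}| |s'| <= C beta e^{- 2 beta (|W| + |E|)}], and [|W| + |E|]
   is bounded below because [E] does not vanish where [W] does. *)
Lemma adiabatic_current_limit (R : realType) (E dE W : R -> R) :
  {within `[0, 1], continuous E} -> {within `[0, 1], continuous W} ->
  {within `[0, 1], continuous dE} ->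
  (forall t : R, 0 < t < 1 -> is_derive t 1 E (dE t)) ->
  (forall t : R, 0 < t < 1 / 2 -> W t < 0) ->
  (forall t : R, 1 / 2 < t < 1 -> 0 < W t) ->
  E 0 = -1 -> E (1 / 2) = 1 -> E 1 = -1 ->
  adiabatic_current E dE W beta @[beta --> +oo] --> (1 : R).
Proof.
move=> cE cW cdE HE Wneg Wpos E0 Eh E1.
have [M M0 HM] := within_bounded cdE.
have cn (f : R -> R) : {within `[0, 1], continuous f} ->
    {within `[0, 1], continuous (fun t => `|f t|)}.
  by move=> cf x; apply: (continuous_comp (cf x)); exact: norm_continuous.
have [t0 t0I Ht0] := EVT_min ler01 (within_add (cn _ cW) (cn _ cE)).
set c := `|W t0| + `|E t0| in Ht0.
have c0 : 0 < c.
  have {t0I} /andP[t00 t01] : 0 <= t0 <= 1 by move: t0I; rewrite in_itv.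
  have EN : E t0 != 0 -> 0 < c.
    by move=> H; rewrite /c ltr_wpDl // normr_gt0.
  have WN : W t0 != 0 -> 0 < c.
    by move=> H; rewrite /c ltr_wpDr // normr_gt0.
  have [u|u|u] := ltgtP t0 (1 / 2).
  - move: t00; rewrite le_eqVlt => /predU1P[v|v].
      by apply: EN; rewrite -v E0 oppr_eq0 oner_eq0.
    by apply: WN; rewrite lt_eqF // Wneg // v u.
  - move: t01; rewrite le_eqVlt => /predU1P[v|v].
      by apply: EN; rewrite v E1 oppr_eq0 oner_eq0.
    by apply: WN; rewrite gt_eqF // Wpos // v u.
  - by apply: EN; rewrite u Eh oner_eq0.
(* From $e^{bc}\ge bc$ follows $2bMe^{-2bc}\le 2bM/(bc)^2=K/b$. The further 2 in [K + 2] comes from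
   the boundary values of $s$. *)
pose K := 2 * M / c ^+ 2.
apply: (@cvg_of_inv_bound _ _ _ (K + 2)) => b b0.
pose s t := logistic (b * E t); pose p t := logistic (b * W t).
pose ds t := dlogistic (b * E t) * (b * dE t).
have cs : {within `[0, 1], continuous s} := within_logistic (within_scale b cE).
have cp : {within `[0, 1], continuous p} := within_logistic (within_scale b cW).
have cds : {within `[0, 1], continuous ds}.
  exact: within_mul (within_dlogistic (within_scale _ cE)) (within_scale _ cdE).
have Hs (t : R) : 0 < t < 1 -> is_derive t 1 s (ds t).
  move=> t01; apply: is_derive_eq.
    exact: is_derive_logistic (is_derive_mul (is_derive_cst b t 1) (HE t t01)).
  by rewrite /ds /=; ring.
(* Applied with $q=p$ where $W>0$ and with $q=1-p$ where $W<0$. *)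
have ds_le (t q : R) : 0 <= t <= 1 -> 0 <= q ->
    q <= expR (- (2 * `|b * W t|)) -> `|q * ds t| <= K / b.
  move=> t01 q0 qW; rewrite normrM ger0_norm //.
  have d_le : `|ds t| <= 2 * expR (- (2 * `|b * E t|)) * (b * M).
    rewrite normrM ler_pM ?dlogistic_le // normrM gtr0_norm //.
    by rewrite ler_pM2l ?HM.
  apply: (le_trans (ler_pM q0 (normr_ge0 _) qW d_le)).
  rewrite [leLHS](_ : _ =
      2 * b * M * (expR (- (2 * `|b * W t|)) * expR (- (2 * `|b * E t|)))); last first.
    by ring.
  rewrite -expRD !normrM gtr0_norm //.
  have le1 : expR (- (2 * (b * `|W t|)) + - (2 * (b * `|E t|))) <= (expR (b * c) ^+ 2)^-1.
    rewrite -expRM_natl -expRN ler_expR -opprD lerN2 -!mulrDr.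
    by rewrite !ler_pM2l // Ht0 // in_itv.
  have le2 : (expR (b * c) ^+ 2)^-1 <= ((b * c) ^+ 2)^-1.
    have bc0 : 0 < b * c by rewrite mulr_gt0.
    rewrite lef_pV2 ?posrE ?exprn_gt0 ?expR_gt0 //.
    rewrite ler_sqr ?nnegrE ?expR_ge0 ?(ltW bc0) //.
    by rewrite (le_trans _ (expR_ge1Dx _)) // lerDr.
  rewrite (_ : K / b = 2 * b * M * ((b * c) ^+ 2)^-1); last first.
    by rewrite /K; field; rewrite !gt_eqF.
  by rewrite ler_wpM2l ?mulr_ge0 ?(ltW b0) // (le_trans le1).
have [P [cP HP EP]] := continuous_primitive ltr01 (within_opp (within_mul cp cds)).
rewrite /adiabatic_current -EP.
have sub (x y : R) (f : R -> R) : 0 <= x -> y <= 1 ->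
    {within `[0, 1], continuous f} -> {within `[x, y], continuous f}.
  move=> x0 y1; apply: continuous_subspaceW => u /=; rewrite !in_itv /=.
  by move=> /andP[u1 u2]; rewrite (le_trans x0) // (le_trans u2).
have h0 : 0 <= 1 / 2 :> R by lra.
have h1 : 1 / 2 <= 1 :> R by lra.
(* On the left half $p$ is near 1, so $-ps'$ is compared with $-s'$: here $S'=(1-p)s'$. *)
pose S t := P t + s t.
have left_half : `|S (1 / 2) - S 0| <= K / b * (1 / 2 - 0).
  apply: (increment_bound (f := S) (df := fun t => (1 - p t) * ds t) h0).
  - exact: sub (lexx 0) h1 (within_add cP cs).
  - move=> t /andP[t0' t1]; have t01 : 0 < t < 1 by rewrite t0' (lt_le_trans t1).
    by apply: is_derive_eq (is_deriveD (HP _ t01) (Hs _ t01)) _; rewrite /=; ring.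
  - move=> t /andP[t0' t1]; have t01 : 0 <= t <= 1.
      by rewrite (ltW t0') (ltW (lt_le_trans t1 h1)).
    have Wt : W t < 0 by rewrite Wneg // t0'.
    rewrite /p -logisticN; apply: ds_le => //; first exact: logistic_ge0.
    by rewrite normrM gtr0_norm // ltr0_norm // mulrN logistic_le.
have right_half : `|P 1 - P (1 / 2)| <= K / b * (1 - 1 / 2).
  apply: (increment_bound (f := P) (df := fun t => - (p t * ds t)) h1).
  - exact: sub h0 (lexx 1) cP.
  - by move=> t /andP[t0' t1]; apply: HP; rewrite (le_lt_trans h0).
  - move=> t /andP[t0' t1]; have t01 : 0 <= t <= 1.
      by rewrite (ltW t1) (ltW (le_lt_trans h0 t0')).
    have Wt : 0 < W t by rewrite Wpos // t0'.
    rewrite normrN; apply: ds_le => //; first exact: logistic_ge0.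
    by rewrite normrM !gtr0_norm // logistic_le.
have sb : logistic b <= b^-1.
  rewrite (le_trans (logistic_le _)) // expRN lef_pV2 ?posrE ?expR_gt0 //.
  by rewrite (le_trans _ (expR_ge1Dx _)) //; lra.
have sb0 := logistic_ge0 b.
(* The boundary values are $s(0)=1-$ [logistic b] and $s(1/2)=$ [logistic b], so $s(0)-s(1/2)$
   misses 1 by [2 * logistic b]. *)
rewrite (_ : P 1 - P 0 - 1 =
  (S (1 / 2) - S 0) + (P 1 - P (1 / 2)) - 2 * logistic b); last first.
  by rewrite /S /s E0 Eh mulr1 mulrN1 logisticN; ring.
rewrite [leRHS]mulrDl; apply: (le_trans (ler_normB _ _)).
apply: lerD; last by rewrite normrM !ger0_norm // ler_pM2l.
apply: (le_trans (ler_normD _ _)); apply: (le_trans (lerD left_half right_half)).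
by rewrite -mulrDr subr0 addrC subrK mulr1.
Qed.

(** * Reduction of the chain complex to coordinates *)

(** Values of [f] outside the interval are arbitrary, so the two-sided derivative is taken at
    interior points only, near which [f] equals its smooth extension. The derivative of the
    extension is continuous up to the endpoints. *)
Lemma smooth_on_C1 (R : realType) (f : R -> R) :
  smooth_on `[0, 1] f ->
  {within `[0, 1], continuous f} /\
  exists df : R -> R, {within `[0, 1], continuous df} /\
    forall t : R, 0 < t < 1 -> is_derive t 1 f (df t).
Proof.
move=> [g [Hg fg]].
have cont (h : R -> R) : (forall x, derivable h x 1) ->
    {within `[0, 1], continuous h}.
  by move=> dh; apply: derivable_within_continuous => x _; exact: dh.
split.
  apply: within_eq (cont _ (Hg 0)) => t /fg; exact: esym.
exists (derive1 g); split; first exact: cont (Hg 1).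
move=> t t01; apply: (@near_eq_is_derive _ _ _ g).
  have /near_in_itvoo : t \in `]0, 1[ by rewrite in_itv.
  apply: filterS => u u01; apply/esym/fg.
  exact: subset_itv_oo_cc u01.
by rewrite derive1E; apply/derivableP/(Hg 0).
Qed.

(** For $d=k+2$ the index [d.-1] computes to [k.+1], so the dimension condition holds by
    conversion. *)
Definition fcell (k : nat) (i : 'I_2) : kcell (Xcomplex k.+2) k.+1 :=
  exist _ (f_ k.+2 i) (eqxx _).

Definition ecell (k : nat) (j : 'I_2) : kcell (Xcomplex k.+2) k.+2 :=
  exist _ (e_ k.+2 j) (eqxx _).

Lemma ord2P (i : 'I_2) : i = ord0 \/ i = ord_max.
Proof. by case: i => -[|[|?]] // ?; [left|right]; exact: val_inj. Qed.

Lemma fcellP (k : nat) (c : kcell (Xcomplex k.+2) k.+1) :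
  c = fcell k ord0 \/ c = fcell k ord_max.
Proof.
case: c => -[[v|i]|j] h.
(* The 0-cell is no $(d-1)$-cell: this uses $d\ge2$. *)
- by [].
- by have [Ei|Ei] := ord2P i; [left|right]; apply: val_inj; rewrite /= Ei.
- by exfalso; move: h => /=; rewrite -[X in _ == X]addn0 -addn1 eqn_add2l.
Qed.

Lemma ecellP (k : nat) (c : kcell (Xcomplex k.+2) k.+2) :
  c = ecell k ord0 \/ c = ecell k ord_max.
Proof.
case: c => -[[v|i]|j] h.
- by [].
- by exfalso; move: h => /=; rewrite -[X in X == _]addn0 -[k.+2]addn1 eqn_add2l.
- by have [Ej|Ej] := ord2P j; [left|right]; apply: val_inj; rewrite /= Ej.
Qed.

(** Hence the only $d$-boundary is 0, and $H_d$ is the group of $d$-cycles. *)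
Lemma no_cell_above (k : nat) (c : kcell (Xcomplex k.+2) k.+3) : False.
Proof.
case: c => -[[v|i]|j] //= h.
  by move: h => /=; rewrite -[X in X == _]addn0 -[k.+3]addn2 eqn_add2l.
by move: h => /=; rewrite -[X in X == _]addn0 -[k.+3]addn1 eqn_add2l.
Qed.

Lemma sum_fcell (A : nmodType) (k : nat)
    (F : kcell (Xcomplex k.+2) k.+1 -> A) :
  \sum_c F c = F (fcell k ord0) + F (fcell k ord_max).
Proof.
rewrite (bigD1 (fcell k ord0)) //= (bigD1 (fcell k ord_max)) //= big1 ?addr0 //.
by move=> c; have [->|->] := fcellP c; rewrite eqxx ?andbF.
Qed.

Lemma sum_ecell (A : nmodType) (k : nat)
    (F : kcell (Xcomplex k.+2) k.+2 -> A) :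
  \sum_c F c = F (ecell k ord0) + F (ecell k ord_max).
Proof.
rewrite (bigD1 (ecell k ord0)) //= (bigD1 (ecell k ord_max)) //= big1 ?addr0 //.
by move=> c; have [->|->] := ecellP c; rewrite eqxx ?andbF.
Qed.

Lemma fchainP (A : comNzRingType) (k : nat) (z z' : chain A (Xcomplex k.+2) k.+1) :
  z (fcell k ord0) = z' (fcell k ord0) ->
  z (fcell k ord_max) = z' (fcell k ord_max) -> z = z'.
Proof.
by move=> H0 H1; apply/ffunP => c; have [->|->] := fcellP c.
Qed.

Lemma echainP (A : comNzRingType) (k : nat) (z z' : chain A (Xcomplex k.+2) k.+2) :
  z (ecell k ord0) = z' (ecell k ord0) ->
  z (ecell k ord_max) = z' (ecell k ord_max) -> z = z'.
Proof.
by move=> H0 H1; apply/ffunP => c; have [->|->] := ecellP c.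
Qed.

Lemma exponent_xyV0 : exponent xyV ord0 = 1.
Proof. by rewrite /exponent !big_cons big_nil. Qed.

Lemma exponent_xyV1 : exponent xyV ord_max = -1.
Proof. by rewrite /exponent !big_cons big_nil. Qed.

Lemma bd_fcell (A : comNzRingType) (k : nat) (c : chain A (Xcomplex k.+2) k.+2) :
  bd c (fcell k ord0) = c (ecell k ord0) + c (ecell k ord_max) /\
  bd c (fcell k ord_max) = - (c (ecell k ord0) + c (ecell k ord_max)).
Proof.
split; rewrite ffunE sum_ecell /=.
  by rewrite exponent_xyV0 !mulr1.
by rewrite exponent_xyV1 mulrN1z !mulrN1 opprD.
Qed.

(** All incidence numbers of a $(d-1)$-cell vanish; for $d=2$ the 1-cells are loops. *)
Lemma is_cycle_fchain (A : comNzRingType) (k : nat) (c : chain A (Xcomplex k.+2) k.+1) :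
  is_cycle c.
Proof.
by apply/ffunP => f; rewrite !ffunE sum_fcell /= !mulr0 addr0.
Qed.

Lemma is_cycle_echain (A : comNzRingType) (k : nat)
    (c : chain A (Xcomplex k.+2) k.+2) :
  is_cycle c <-> c (ecell k ord0) + c (ecell k ord_max) = 0.
Proof.
have [b0 b1] := bd_fcell c; rewrite /is_cycle; split=> [bc|c0].
  by rewrite -b0 bc ffunE.
by apply: fchainP; rewrite ?b0 ?b1 c0 ffunE ?oppr0.
Qed.

(** The boundaries are the multiples of $f_1-f_2$, so the coordinate sum is a complete invariant of
    the class. A multiple of $e_1$ suffices as bounding chain. *)
Lemma homologous_fchain (A : comNzRingType) (k : nat)
    (z z' : chain A (Xcomplex k.+2) k.+1) :
  homologous z z' <->
  z (fcell k ord0) + z (fcell k ord_max) =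
  z' (fcell k ord0) + z' (fcell k ord_max).
Proof.
split=> [[b zb]|zz'].
  have [b0 b1] := bd_fcell b; move: b0 b1; rewrite -zb !ffunE => b0 b1.
  apply/eqP; rewrite -subr_eq0 opprD addrACA b0 b1.
  by rewrite subrr.
pose b : chain A (Xcomplex k.+2) k.+2 :=
  [ffun c => if val c == e_ k.+2 ord0
             then z (fcell k ord0) - z' (fcell k ord0) else 0].
have [b0 b1] := bd_fcell b.
exists b; apply: fchainP; rewrite ?b0 ?b1 !ffunE /= addr0 // opprB.
by apply/eqP; rewrite subr_eq addrAC eq_sym subr_eq -zz' addrC.
Qed.

Lemma homologous_echain (A : comNzRingType) (k : nat)
    (c c' : chain A (Xcomplex k.+2) k.+2) : homologous c c' <-> c = c'.
Proof.
split=> [[b cb]|->].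
  apply/eqP; rewrite -subr_eq0 cb; apply/eqP/ffunP => e; rewrite !ffunE.
  by apply: big1 => x; case: (no_cell_above x).
by exists 0; apply/ffunP => e; rewrite !ffunE subrr big1 // => x; case: (no_cell_above x).
Qed.

Lemma f1_coord (k : nat) :
  f1 k.+2 (fcell k ord0) = 1 /\ f1 k.+2 (fcell k ord_max) = 0.
Proof. by split; rewrite ffunE. Qed.

Lemma e1Be2_coord (k : nat) :
  (e1 k.+2 - e2 k.+2) (ecell k ord0) = 1 /\
  (e1 k.+2 - e2 k.+2) (ecell k ord_max) = -1.
Proof. by split; rewrite !ffunE. Qed.

Lemma generates_f1 (k : nat) : generates_homology (f1 k.+2).
Proof.
split; first exact: is_cycle_fchain.
move=> c _; exists (c (fcell k ord0) + c (fcell k ord_max)).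
have [f10 f11] := f1_coord k.
have E m : homologous c (f1 k.+2 *~ m) <-> c (fcell k ord0) + c (fcell k ord_max) = m.
  by rewrite homologous_fchain !ffunMzE f10 f11 mul0rz addr0 intz.
by split=> [|m]; rewrite E.
Qed.

Lemma generates_e1Be2 (k : nat) : generates_homology (e1 k.+2 - e2 k.+2).
Proof.
have [e0 e1] := e1Be2_coord k.
split; first by apply/is_cycle_echain; rewrite e0 e1 subrr.
move=> c /is_cycle_echain c0; exists (c (ecell k ord0)); split=> [|m].
  apply/homologous_echain/echainP; rewrite ffunMzE ?e0 ?e1 ?mulNrz intz //.
  by apply/eqP; rewrite -addr_eq0 addrC c0.
by move=> /homologous_echain ->; rewrite ffunMzE e0 intz.
Qed.

(** * Flux, periodic solutions and average current in coordinates *)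

Lemma expRN_logistic (R : realType) (w e x : R) :
  expR (- w) * (expR e * x - expR (- e) * (1 - x)) =
  logistic w * ((expR w + expR (- w)) * (expR e + expR (- e)) *
                (x - logistic e)).
Proof.
(* With $p$ and $s$ the logistic values at $w$ and $e$, this multiplies $e^{-w}=p(e^w+e^{-w})$ by
   $e^ex-e^{-e}(1-x)=(e^e+e^{-e})(x-s)$. *)
have d z := lt0r_neq0 (logistic_den_gt0 (z : R)).
move: (d w) (d e); rewrite /logistic !expRM_natl !expRN => dw de; field.
by rewrite dw de !gt_eqF ?expR_gt0.
Qed.

(** Both $d$-cells have the same boundary, so their fluxes differ only by the sign of $W$ in the
    exponential. *)
Lemma flux_ecell (R : realType) (k : nat) (E W : R -> R) (tau beta t : R)
    (x : R -> R) (q : chain R (Xcomplex k.+2) k.+1) :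
  q (fcell k ord0) = x t -> q (fcell k ord0) + q (fcell k ord_max) = 1 ->
  let J := @flux R (Xcomplex k.+2) k.+2 (opposite_weights k.+2 E)
    (opposite_weights k.+2 W) beta t q in
  tau * J (ecell k ord0) = current_density E W tau beta x t /\
  tau * J (ecell k ord_max) =
    current_density E (fun t => - W t) tau beta x t.
Proof.
move=> q0 q1; have q1E : q (fcell k ord_max) = 1 - x t.
  by rewrite -q1 q0 addrAC subrr add0r.
split; rewrite !ffunE !sum_fcell !ffunE /= q1E q0 exponent_xyV0 exponent_xyV1;
  rewrite mulr1z mul1r mulrN1z mulN1r ?mulrN ?mulNr;
  by rewrite expRN_logistic /current_density /rate ?mulrN.
Qed.

Lemma current_densityD (R : realType) (E W x : R -> R) (tau beta t : R) :
  current_density E W tau beta x t +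
  current_density E (fun t => - W t) tau beta x t =
  tau * (rate E W beta t * (x t - logistic (beta * E t))).
Proof. by rewrite /current_density mulrN logisticN /rate mulrN opprK; ring. Qed.

Lemma bd_flux (R : realType) (k : nat) (E W : R -> R) (tau beta t : R)
    (x : R -> R) (q : chain R (Xcomplex k.+2) k.+1) :
  q (fcell k ord0) = x t -> q (fcell k ord0) + q (fcell k ord_max) = 1 ->
  let J := @flux R (Xcomplex k.+2) k.+2 (opposite_weights k.+2 E)
    (opposite_weights k.+2 W) beta t q in
  - tau * bd J (fcell k ord0) =
    - tau * (rate E W beta t * (x t - logistic (beta * E t))) /\
  - tau * bd J (fcell k ord_max) =
    tau * (rate E W beta t * (x t - logistic (beta * E t))).
Proof.
move=> q0 q1 J; have [J0 J1] := flux_ecell E W tau beta q0 q1.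
have [-> ->] := bd_fcell J.
by rewrite !mulNr mulrN opprK mulrDr J0 J1 current_densityD.
Qed.

Lemma homologous_z0 (R : realType) (k : nat) (q : chain R (Xcomplex k.+2) k.+1) :
  homologous q (realify R (f1 k.+2)) <->
  q (fcell k ord0) + q (fcell k ord_max) = 1.
Proof.
by rewrite homologous_fchain !ffunE /= addr0.
Qed.

(** The homology class fixes the coordinate sum, which closes the equation for the coefficient of
    $f_1$. *)
Lemma periodic_solution_scalar (R : realType) (k : nat) (E W : R -> R)
    (tau beta : R) (rho : R -> chain R (Xcomplex k.+2) k.+1) :
  @periodic_solution R (Xcomplex k.+2) k.+2 (opposite_weights k.+2 E)
    (opposite_weights k.+2 W) (realify R (f1 k.+2)) tau beta rho ->
  scalar_solution E W tau beta (fun t => rho t (fcell k ord0)) /\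
  forall t : R, 0 <= t <= 1 -> rho t (fcell k ord0) + rho t (fcell k ord_max) = 1.
Proof.
move=> [crho Hrho rho01 zrho].
have rho1 (t : R) : 0 <= t <= 1 -> rho t (fcell k ord0) + rho t (fcell k ord_max) = 1.
  by move=> /zrho[_ /homologous_z0].
split=> //; split=> [|t t01|]; [exact: crho| |by rewrite rho01].
have [<- _] := bd_flux (x := fun t => rho t (fcell k ord0)) E W tau beta
  (erefl _) (rho1 t (subset_itv_oo_cc t01)).
exact: Hrho.
Qed.

Lemma scalar_periodic_solution (R : realType) (k : nat) (E W : R -> R)
    (tau beta : R) (x : R -> R) :
  scalar_solution E W tau beta x ->
  @periodic_solution R (Xcomplex k.+2) k.+2 (opposite_weights k.+2 E)
    (opposite_weights k.+2 W) (realify R (f1 k.+2)) tau beta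
    (fun t => [ffun c => if c == fcell k ord0 then x t else 1 - x t]).
Proof.
move=> [cx Hx x01].
pose rho (t : R) : chain R (Xcomplex k.+2) k.+1 :=
  [ffun c => if c == fcell k ord0 then x t else 1 - x t].
have r0 t : rho t (fcell k ord0) = x t by rewrite ffunE eqxx.
have r1 t : rho t (fcell k ord_max) = 1 - x t by rewrite ffunE.
have rho1 t : rho t (fcell k ord0) + rho t (fcell k ord_max) = 1.
  by rewrite r0 r1 addrC subrK.
have E0 : (fun t => rho t (fcell k ord0)) = x by apply/funext.
have E1 : (fun t => rho t (fcell k ord_max)) = (fun t => 1 - x t) by apply/funext.
rewrite -/rho; split.
- move=> f; have [->|->] := fcellP f; rewrite ?E0 ?E1 //.
  exact: within_add (@within_cst _ _ _) (within_opp cx).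
- move=> t f t01; have [b0 b1] := bd_flux E W tau beta (r0 t) (rho1 t).
  have [->|->] := fcellP f; rewrite ?E0 ?E1 ?b0 ?b1; first exact: Hx.
  by apply: is_derive_eq (is_deriveB (is_derive_cst _ t 1) (Hx t t01)) _; ring.
- by apply/ffunP => f; rewrite !ffunE x01.
- by move=> t _; split; [exact: is_cycle_fchain|exact/homologous_z0].
Qed.

Lemma average_current_scalar (R : realType) (k : nat) (E W : R -> R)
    (tau beta : R) (x : R -> R) :
  {within `[0, 1], continuous E} -> {within `[0, 1], continuous W} ->
  0 < tau -> scalar_solution E W tau beta x ->
  let Q := @average_current R (Xcomplex k.+2) k.+2 (opposite_weights k.+2 E)
    (opposite_weights k.+2 W) (realify R (f1 k.+2)) tau beta in
  Q (ecell k ord0) =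
    \int[lebesgue_measure]_(t in `[0, 1]) current_density E W tau beta x t /\
  Q (ecell k ord_max) = - Q (ecell k ord0).
Proof.
move=> cE cW tau0 sol.
rewrite /average_current; set rho := xget _ _.
(* Since a periodic solution exists, [xget] returns one and not its default 0. By uniqueness its
   $f_1$-coefficient is [x] on $[0,1]$, whichever one is chosen. *)
have /periodic_solution_scalar[rsol rho1] :=
  xgetI (fun=> 0) (scalar_periodic_solution k sol).
rewrite -/rho in rsol rho1.
have rx := scalar_solution_unique cE cW tau0 rsol sol.
have Q0 : \int[lebesgue_measure]_(t in `[0, 1])
    (tau * @flux R (Xcomplex k.+2) k.+2 (opposite_weights k.+2 E)
      (opposite_weights k.+2 W) beta t (rho t) (ecell k ord0)) =
    \int[lebesgue_measure]_(t in `[0, 1]) current_density E W tau beta x t.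
  apply: eq_Rintegral => t /set_mem /=; rewrite in_itv /= => t01.
  by have [-> _] := flux_ecell E W tau beta (rx t t01) (rho1 t t01).
rewrite !ffunE Q0; split=> //.
rewrite -(current_density_cycle cE cW sol).
apply: eq_Rintegral => t /set_mem /=; rewrite in_itv /= => t01.
by have [_ ->] := flux_ecell E W tau beta (rx t t01) (rho1 t t01).
Qed.

(** * Generators, well-posedness and the two successive limits *)

Theorem theorem4 (R : realType) (d : nat) (hd : (2 <= d)%N) (W1 E1 : R -> R)
  (W1_smooth : smooth_on `[0, 1] W1)
  (W1_range : forall t : R, 0 <= t <= 1 -> -1 <= W1 t <= 1)
  (W1_0 : W1 0 = 0) (W1_half : W1 (1 / 2) = 0) (W1_1 : W1 1 = 0)
  (W1_neg : forall t : R, 0 < t < 1 / 2 -> W1 t < 0)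
  (W1_pos : forall t : R, 1 / 2 < t < 1 -> 0 < W1 t)
  (E1_smooth : smooth_on `[0, 1] E1)
  (E1_range : forall t : R, 0 <= t <= 1 -> -1 <= E1 t <= 1)
  (E1_half : E1 (1 / 2) = 1) (E1_0 : E1 0 = -1) (E1_1 : E1 1 = -1) :
  let E := opposite_weights d E1 in
  let W := opposite_weights d W1 in
  let z0 := realify R (f1 d) in
  let Q := average_current E W z0 in
  [/\ generates_homology (f1 d),
      generates_homology (e1 d - e2 d),
      forall beta : R, 0 < beta -> \forall tau \near +oo,
        has_unique_periodic_solution E W z0 tau beta /\ is_cycle (Q tau beta)
    & exists Qad : R -> chain R (Xcomplex d) d,
        (forall beta : R, 0 < beta ->
           chain_cvg (fun tau => Q tau beta) +oo (Qad beta)) /\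
        chain_cvg Qad +oo (realify R (e1 d - e2 d))].
Proof.
case: d hd => [|[|k]] // _ E W z0 Q.
have [cW [dW [cdW HW]]] := smooth_on_C1 W1_smooth.
have [cE [dE [cdE HE]]] := smooth_on_C1 E1_smooth.
have E01 : E1 0 = E1 1 by rewrite E1_0 E1_1.
have W01 : W1 0 = W1 1 by rewrite W1_0 W1_1.
have Q_opp tau beta : 0 < tau ->
    Q tau beta (ecell k ord_max) = - Q tau beta (ecell k ord0).
  move=> tau0; have [x sol] := scalar_solution_exists beta cE cW tau0.
  by have [_ ->] := average_current_scalar k cE cW tau0 sol.
split; [exact: generates_f1|exact: generates_e1Be2| |].
- move=> beta _; near=> tau.
  (* Existence and uniqueness hold for every positive $\tau$, so eventual positivity is all that
     large $\tau$ has to supply. *)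
  have tau0 : 0 < tau by near: tau; apply: nbhs_pinfty_gt; exact: num_real.
  split; last by apply/is_cycle_echain; rewrite Q_opp // subrr.
  have [x sol] := scalar_solution_exists beta cE cW tau0.
  have psol := scalar_periodic_solution k sol.
  exists (fun t => [ffun c => if c == fcell k ord0 then x t else 1 - x t]).
  split=> // rho' /periodic_solution_scalar[sol' rho'1] t t01.
  have x't : rho' t (fcell k ord0) = x t.
    exact: scalar_solution_unique cE cW tau0 sol' sol t t01.
  apply: fchainP; rewrite !ffunE /= ?x't //.
  by rewrite -x't -(rho'1 t t01) addrAC subrr add0r.
pose q := adiabatic_current E1 dE W1.
(* The adiabatic limit is [q beta] times $e_1-e_2$, so the low temperature limit reduces to that of
   the scalar [q beta]. *)
exists (fun beta => [ffun e => if e == ecell k ord0 then q beta else - q beta]).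
split=> [beta beta0|].
  have [C HC] := adiabatic_bound cE cW cdE cdW HE HW E01 W01 beta0.
  have Q0 tau : 0 < tau -> `|Q tau beta (ecell k ord0) - q beta| <= C / tau.
    move=> tau0; have [x sol] := scalar_solution_exists beta cE cW tau0.
    have [-> _] := average_current_scalar k cE cW tau0 sol.
    exact: HC tau0 sol.
  move=> e; have [->|->] := ecellP e; rewrite ffunE /=;
    apply: (@cvg_of_inv_bound _ _ _ C) => tau tau0; first exact: Q0.
  by rewrite Q_opp // -opprD normrN Q0.
have q1 := adiabatic_current_limit cE cW cdE HE W1_neg W1_pos E1_0 E1_half E1_1.
have [e0 e1] := e1Be2_coord k.
move=> e; have [->|->] := ecellP e; rewrite [X in _ --> X]ffunE ?e0 ?e1.
  by under eq_fun do rewrite ffunE eqxx.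
under eq_fun do rewrite ffunE /=.
by rewrite mulrN1z; exact: cvgN.
Unshelve. all: by end_near.
Qed.
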